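(* Let $G$ be a connected graph and let $c$ be a $k$-vertex colouring of $G$, where $k$ is an infinite cardinal. Then there is a $k$-edge colouring $c'$ of $G$ which is less symmetric than $c$.
   Context: Graphs are simple and undirected, with no restriction on the cardinality of the vertex set or on vertex degrees. A $k$-vertex colouring of $G=(V,E)$ is a function $V\to C$ with $|C|=k$; a $k$-edge colouring is a function $E\to C$ with $|C|=k$. An automorphism $\gamma\in\operatorname{Aut}G$ preserves a vertex colouring $c$ if $c(\gamma v)=c(v)$ for all $v\in V$ (analogously for edge colourings, with $\gamma$ acting on edges). The stabiliser of a colouring is the set of automorphisms of $G$ preserving it. A (vertex or edge) colouring $c'$ is less symmetric than a (vertex or edge) colouring $c$ if the stabiliser of $c'$ is contained in the stabiliser of $c$.
   Formalization: The connected graph G is assumed not to be the complete graph on two vertices; there the claim fails when c gives the two vertices different colours, since swapping them preserves every edge colouring but not c. *)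

(* Defs.v *)
From Stdlib Require Export Relations.Relation_Operators.
From mathcomp Require Export all_boot boolp classical_sets functions cardinality.

Set Implicit Arguments.
Unset Strict Implicit.
Unset Printing Implicit Defensive.

Local Open Scope classical_set_scope.
Local Open Scope card_scope.

(* V is an arbitrary type: neither its size nor the degrees are restricted. *)
Record graph (V : Type) := Graph {
  adj : V -> V -> Prop;
  adj_sym : forall u v, adj u v -> adj v u;
  adj_irrefl : forall v, ~ adj v v
}.

Definition connected_graph V (G : graph V) : Prop :=
  forall u v, clos_refl_trans V (adj G) u v.

(* K_2 is the exceptional connected graph: exchanging its two vertices fixes its
   only edge, hence preserves every edge colouring, but it need not preserve a
   vertex colouring. *)
Definition is_K2 V (G : graph V) : Prop :=
  exists u v, adj G u v /\ forall w, w = u \/ w = v.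

Definition edge_set V (G : graph V) : set (set V) :=
  [set e | exists u v, adj G u v /\ e = [set u; v]].

Definition edge V (G : graph V) : Type := {e : set V | edge_set G e}.

Record automorphism V (G : graph V) := Automorphism {
  aut_fun :> V -> V;
  aut_bij : bijective aut_fun;
  aut_adj : forall u v, adj G (aut_fun u) (aut_fun v) <-> adj G u v
}.

Lemma aut_edge_set V (G : graph V) (g : automorphism G) (e : set V) :
  edge_set G e -> edge_set G (g @` e).
Proof.
move=> [u [v [uv ->]]]; exists (g u), (g v).
by split; [exact/aut_adj | rewrite image_setU !image_set1].
Qed.

Definition aut_edge V (G : graph V) (g : automorphism G) (e : edge G) : edge G :=
  exist _ (g @` sval e) (aut_edge_set g (svalP e)).

(* A cardinal k is given by a type K of that cardinality; the colour set is any
   type equipotent to K. A colouring need not use every colour. *)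
Record colouring (K X : Type) := Colouring {
  colour_set : Type;
  colour_set_card : [set: colour_set] #= [set: K];
  colour :> X -> colour_set
}.

Inductive graph_colouring (K V : Type) (G : graph V) :=
| VertexColouring of colouring K V
| EdgeColouring of colouring K (edge G).
Arguments VertexColouring {K V G} c.
Arguments EdgeColouring {K V G} c.

Definition preserves K V (G : graph V) (g : automorphism G)
    (c : graph_colouring K G) : Prop :=
  match c with
  | VertexColouring c => forall v : V, c (g v) = c v
  | EdgeColouring c => forall e : edge G, c (aut_edge g e) = c e
  end.

Definition stabiliser K V (G : graph V) (c : graph_colouring K G) :
    set (automorphism G) :=
  [set g | preserves g c].

Definition less_symmetric K' K V (G : graph V)
    (c' : graph_colouring K' G) (c : graph_colouring K G) : Prop :=
  stabiliser c' `<=` stabiliser c.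

(* Main.v *)
Require Import Defs.
Set Implicit Arguments.
Unset Strict Implicit.
Local Open Scope classical_set_scope.

(** Root [G] at a vertex [v] with two distinct neighbours [a] and [b]. Give the
    edges [va] and [vb] two colours of their own, and every other edge the
    vertex colour of its endpoint farther from [v]. An automorphism preserving
    this edge colouring fixes [va] and [vb], hence [v], [a] and [b]; so it
    preserves the distance to [v], and every other vertex [w] is the farther
    endpoint of some edge, whose colour shows that the image of [w] has the same
    colour as [w]. Only two extra colours are needed, and an infinite colour set
    has room for them. *)

(** Hilbert's hotel: along a copy [i] of the natural numbers inside [K], shift every element by two
    places and fix all the others. This frees [i 0] and [i 1] for the two extra points. *)
Lemma infinite_option2_injection (K : Type) :
  infinite_set [set: K] ->
  exists f : option (option K) -> K, injective f.
Proof.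
elim/Ppointed: K => K; first by rewrite emptyE => /(_ (finite_set0 _)).
case/infiniteP/pcard_injP => i /in2TT i_inj.
have /choice[s sP] : forall x, exists y,
    (exists2 n, x = i n & y = i n.+2) \/ ((forall n, x <> i n) /\ y = x).
  move=> x; have [[n xn]|xi] := pselect (exists n, x = i n).
    by exists (i n.+2); left; exists n.
  by exists x; right; split=> // n xn; apply: xi; exists n.
have s_avoids x j : j < 2 -> s x <> i j.
  by case: (sP x) => [[n _ ->] j2 /i_inj nj|[xi ->] _ //]; rewrite -nj in j2.
have s_inj : injective s.
  move=> x y; case: (sP x) (sP y) => [[m -> ->]|[xi ->]] [[n -> ->]|[yi ->]] //.
  - by case/i_inj => ->.
  - by move/esym/yi.
  - by move/xi.
exists (fun o => match o with
                 | None => i 0 | Some None => i 1 | Some (Some x) => s x end).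
move=> [[x|]|] [[y|]|] //.
- by move/s_inj ->.
- by move/s_avoids => /(_ isT).
- by move/s_avoids => /(_ isT).
- by move/esym/s_avoids => /(_ isT).
- by move/i_inj.
- by move/esym/s_avoids => /(_ isT).
- by move/i_inj.
Qed.

Section Graphs.
Variables (V : Type) (G : graph V).

Lemma connected_ind (P : V -> Prop) (v : V) :
  connected_graph G -> P v -> (forall x y, adj G x y -> P x -> P y) ->
  forall w, P w.
Proof.
move=> connG Pv Padj w; elim: (connG v w) Pv => // x y z _ IH1 _ IH2 /IH1 //.
Qed.

(** If no vertex had two neighbours, the pair of [x] and [y] would be closed under adjacency, hence
    by connectedness the whole graph. *)
Lemma exists_two_neighbours (x y : V) :
  connected_graph G -> ~ is_K2 G -> adj G x y ->
  exists v a b, [/\ adj G v a, adj G v b & a <> b].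
Proof.
move=> connG nK2 xy; apply: contrapT => deg1.
have same v a b : adj G v a -> adj G v b -> a = b.
  by move=> va vb; apply: contrapT => ab; apply: deg1; exists v, a, b.
apply: nK2; exists x, y; split=> //.
apply: (@connected_ind _ x) => //; first by left.
move=> u w uw [ux|uy]; subst u.
- by right; apply: same uw xy.
- by left; apply: same uw (adj_sym xy).
Qed.

(** Distances to [v] are compared through membership in these increasing balls, so no distance
    function is needed. *)
Fixpoint ball (v : V) (n : nat) : set V :=
  if n is m.+1 then ball v m `|` [set w | exists2 u, ball v m u & adj G u w]
  else [set v].

Lemma ball_mono v m n : m <= n -> ball v m `<=` ball v n.
Proof.
by move=> /subnK <- u; elim: (n - m) => //= d IH /IH; left.
Qed.

Lemma ball_aut (g : automorphism G) v n u :
  g v = v -> ball v n (g u) <-> ball v n u.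
Proof.
move=> gv; have [h hg gh] := aut_bij g.
elim: n u => [|n IH] u /=.
  by split=> [|->//]; rewrite -{1}gv => /(can_inj hg).
split; (case=> [/IH|[y]]; first by left).
- rewrite -(gh y) => /IH yn /aut_adj yu; right; by exists (h y).
- move=> /IH yn yu; right; exists (g y) => //; exact/aut_adj.
Qed.

Lemma ball_cover v w : connected_graph G -> exists n, ball v n w.
Proof.
move=> connG; move: w; apply: (@connected_ind _ v) => //; first by exists 0.
by move=> x y xy [n xn]; exists n.+1; right; exists x.
Qed.

(** The radius [n] witnesses that [w] is strictly farther from [v] than [u]; an edge between
    equidistant vertices has no farther end. *)
Definition farther_end (v : V) (e : set V) (w : V) : Prop :=
  exists u n, [/\ e = [set u; w], ball v n u & ~ ball v n w].

(** If both ends were farther, each would lie in a ball that misses the other. Balls around [v] are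
    nested, so the larger of the two contains both ends, a contradiction. *)
Lemma farther_end_unique v e w w' :
  farther_end v e w -> farther_end v e w' -> w = w'.
Proof.
move=> [u [n [-> un wn]]] [u' [m [e' um wm]]].
have : [set u; w] w' by rewrite e'; right.
case=> [w'u|-> //]; have : [set u; w] u' by rewrite e'; left.
rewrite /= in w'u *; subst w'; case=> /= u'E; subst u'; first by case: wm.
case: (leqP n m) => [/ball_mono nm|/ltnW/ball_mono mn].
- by case: wm; apply: nm.
- by case: wn; apply: mn.
Qed.

End Graphs.

(** The image of [v] lies on both edges, which share only [v]; injectivity then fixes the other
    ends. *)
Lemma fixed_edges_fix_ends V (G : graph V) (g : automorphism G) v a b :
  adj G v a -> adj G v b -> a <> b ->
  g @` [set v; a] = [set v; a] -> g @` [set v; b] = [set v; b] ->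
  [/\ g v = v, g a = a & g b = b].
Proof.
move=> va vb ab ea eb; have [h hg _] := aut_bij g.
have img x y z : g @` [set x; y] = [set x; y] -> [set x; y] z ->
    g z = x \/ g z = y.
  by move=> e xyz; have : [set x; y] (g z) by rewrite -e; exists z.
have gv : g v = v.
  case: (img _ _ v ea) => //; first by left.
  move=> gva; case: (img _ _ v eb) => //; first by left.
  by rewrite gva.
have fix_nbr x : adj G v x -> g @` [set v; x] = [set v; x] -> g x = x.
  move=> vx e; case: (img _ _ x e) => //; first by right.
  rewrite -{1}gv => /(can_inj hg) xv; subst x.
  by case: (adj_irrefl vx).
by split=> //; apply: fix_nbr.
Qed.

Theorem theorem2 (K V : Type) (G : graph V)
    (K_infinite : infinite_set [set: K])
    (G_connected : connected_graph G)
    (G_not_K2 : ~ is_K2 G)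
    (c : colouring K V) :
  exists c' : colouring K (edge G),
    less_symmetric (EdgeColouring c') (VertexColouring (G := G) c).
Proof.
have C_infinite : infinite_set [set: colour_set c].
  by rewrite (eq_finite_set (colour_set_card c)).
have [code code_inj] := infinite_option2_injection C_infinite.
have [[x [y xy]]|noadj] := pselect (exists x y, adj G x y); last first.
  (* Without edges, connectedness leaves a single vertex, so every automorphism is the identity and
     any colouring will do. *)
  exists (Colouring (colour_set_card c) (fun _ => code None)) => g _ w.
  congr (c _); move: (g w); apply: (@connected_ind _ G _ w) => // u z uz.
  by case: noadj; exists u, z.
have [v [a [b [va vb ab]]]] := exists_two_neighbours G_connected G_not_K2 xy.
have [far farP] : exists far : set V -> V,
    forall e w, farther_end G v e w -> far e = w.
  have /choice[far farP] : forall e : set V, exists w,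
      forall w', farther_end G v e w' -> w = w'.
    move=> e; have [[w ew]|none] := pselect (exists w, farther_end G v e w).
      by exists w => w'; apply: farther_end_unique ew.
    (* The value [v] is a dummy, for sets without a farther end. *)
    by exists v => w ew; case: none; exists w.
  by exists far.
pose label (e : set V) : option (option (colour_set c)) :=
  if `[< e = [set v; a] >] then None
  else if `[< e = [set v; b] >] then Some None
  else Some (Some (c (far e))).
exists (Colouring (colour_set_card c) (fun e : edge G => code (label (sval e)))).
move=> g g_pres.
have g_label u w : adj G u w -> label (g @` [set u; w]) = label [set u; w].
  move=> uw; have ew : edge_set G [set u; w] by exists u, w.
  exact: code_inj (g_pres (exist _ _ ew)).
have b_label e : label e = Some None -> e = [set v; b].
  by rewrite /label; case: asboolP => // _; case: asboolP.
have ba : [set v; b] <> [set v; a].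
  move=> E; have : [set v; a] b by rewrite -E; right.
  case=> /= bE; last exact: ab.
  by rewrite bE in vb; case: (adj_irrefl vb).
have ea : g @` [set v; a] = [set v; a].
  move: (g_label _ _ va); rewrite /label [in RHS]asboolT //.
  by case: asboolP => // _; case: asboolP.
have eb : g @` [set v; b] = [set v; b].
  apply: b_label; rewrite g_label // /label asboolF // asboolT //.
have [gv ga gb] := fixed_edges_fix_ends va vb ab ea eb.
have vball n : ball G v n v by exact: (@ball_mono _ G v 0 n (leq0n n)).
move=> w; have [n] := ball_cover v w G_connected.
(* Induction on the radius of a ball containing [w]. In the new case [w] lies outside the ball of
   radius [n] and its neighbour [u] inside, so [w] is the farther end of the edge [uw]. *)
elim: n w => [w ->|n IH w [/IH //|[u un uw]]]; first by rewrite gv.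
have [/IH //|wn] := pselect (ball G v n w).
have wE z : [set u; w] = [set v; z] -> w = z.
  move=> E; have : [set v; z] w by rewrite -E; right.
  by case=> // wv; case: wn; rewrite wv.
move: (g_label _ _ uw); rewrite /label.
case: (asboolP ([set u; w] = _)) => [/wE ->|_]; first by rewrite ga.
case: (asboolP ([set u; w] = _)) => [/wE ->|_]; first by rewrite gb.
(* The image edge cannot carry a reserved label either, so both labels are vertex colours of farther
   ends; that of the image is [g w], because [g] preserves the balls around [v]. *)
case: asboolP => // _; case: asboolP => // _ [].
rewrite (farP [set u; w] w); last by exists u, n.
rewrite (farP _ (g w)) //; exists (g u), n.
by rewrite image_setU !image_set1; split=> //; rewrite ball_aut.
Qed.
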